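(* Let $\mathcal{G}=\langle\Upsilon,\mathcal{E}\rangle$ be (the matrix representation of) an instance of ST-Realizability on $n$ vertices. Then its transitive closure $\mathcal{G}^*=\langle\Upsilon^*,\mathcal{E}^*\rangle$ can be computed using $O(\log n)$ repeated applications of the operation $\mathbf{Square}$ starting from $\langle\Upsilon,\mathcal{E}\rangle$.
   Context: Realizable strings over $\{push,pop,\epsilon,\alpha_1,\dots,\alpha_k\}$ are the nonempty strings defined recursively by: ''$\alpha_i$''; ''$\alpha_i\,\epsilon\,\alpha_i$''; ''$\alpha_i\ push\ S\ pop\ \alpha_i$'' for realizable $S$; and ''$\alpha_i S_1\alpha_i S_2\alpha_i$'' whenever ''$\alpha_i S_1\alpha_i$'' and ''$\alpha_i S_2\alpha_i$'' are realizable. An instance of ST-Realizability is a directed graph on vertex set $V$, $|V|=n$, with vertex labels $\mathcal{L}(u)\in\{\alpha_1,\dots,\alpha_k\}$ and edge labels in $\{push,pop,\epsilon\}$ (no multi-edges). Write $a\leadsto b$ if there is a directed path from $a$ to $b$ whose concatenated vertex and edge labels form a realizable string. $(a,b)$ is realizable with gap $(c,d)$, written $a\leadsto(c,d)\leadsto b$, if there are directed paths $P_1$ from $a$ to $c$ and $P_2$ from $d$ to $b$, $a,b$ have the same label, $c,d$ have the same label, and the label string of the path obtained by concatenating $P_1$ and $P_2$ with $c$ and $d$ identified is realizable. Representation: $\mathcal{E}$ is the $n\times n$ Boolean matrix with $\mathcal{E}[u,v]=1$ iff $(u,v)$ is an edge labeled $\epsilon$, and $\mathcal{E}[u,u]=1$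 for all $u$. $\Upsilon$ is the Boolean array indexed by $[a,(c,d),b]$, $a,b,c,d\in V$, with $\Upsilon[a,(c,d),b]=1$ iff either ($(a,c)$ is a push edge, $(d,b)$ is a pop edge, $\mathcal{L}(a)=\mathcal{L}(b)$ and $\mathcal{L}(c)=\mathcal{L}(d)$), or $a=b=c=d$, or ($c=a$ and $d=b$). The transitive closure $\mathcal{G}^*=\langle\Upsilon^*,\mathcal{E}^*\rangle$ has $\mathcal{E}^*[a,b]=1$ iff $a\leadsto b$ and $\Upsilon^*[a,(c,d),b]=1$ iff $a\leadsto(c,d)\leadsto b$. With Boolean sums ($\vee$) and products ($\wedge$), $\mathbf{Square}(\langle\Upsilon,\mathcal{E}\rangle)$ first replaces, for all $a,b$, $\mathcal{E}[a,b]$ by $\sum_{c,e,f,g,d}\Upsilon[a,(c,d),b]\,\Upsilon[c,(e,f),g]\,\mathcal{E}[e,f]\,\mathcal{E}[g,d]$, and then (using the updated $\mathcal{E}$) replaces, for all $a,b,c,d$, $\Upsilon[a,(c,d),b]$ by $\sum_{c',e',f',g',d'}\Upsilon[a,(c',d'),b]\,\Upsilon[c',(e',f'),g']\,\Upsilon[e',(c,d),f']\,\mathcal{E}[g',d'] + \sum_{c',e',f',g',d'}\Upsilon[a,(c',d'),b]\,\Upsilon[c',(e',f'),g']\,\mathcal{E}[e',f']\,\Upsilon[g',(c,d),d']$, and returns the new pair.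
   Formalization: Trivial-gap entries of Υ and ε entries of E are recorded only between equally labeled vertices, and realizable pairs are assumed to have a realizable string of length at most n^p (O-constant depends on p); without these the claim fails, as shortest realizable paths can be exponential. *)

(* Defs.v *)
From HB Require Import structures.
From mathcomp Require Import all_boot.

Set Implicit Arguments.
Unset Strict Implicit.
Unset Printing Implicit Defensive.

Variant edge_label := Push | Pop | Eps.

Definition edge_label_eqb (x y : edge_label) : bool :=
  match x, y with
  | Push, Push | Pop, Pop | Eps, Eps => true
  | _, _ => false
  end.

Lemma edge_label_eqP : Equality.axiom edge_label_eqb.
Proof. by case; case; constructor. Qed.

HB.instance Definition _ := hasDecEq.Build edge_label edge_label_eqP.

(* The alphabet {push, pop, eps, alpha_1, ..., alpha_k}. *)
Variant letter (k : nat) :=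
  | Edge of edge_label
  | Alpha of 'I_k.
Arguments Edge {k} _.
Arguments Alpha {k} _.

(* In [realizable_cat], [S1] and [S2] are arbitrary strings: only
   "alpha_i S1 alpha_i" and "alpha_i S2 alpha_i" have to be realizable. *)
Inductive realizable (k : nat) : seq (letter k) -> Prop :=
  | realizable_one (i : 'I_k) :
      realizable [:: Alpha i]
  | realizable_eps (i : 'I_k) :
      realizable [:: Alpha i; Edge Eps; Alpha i]
  | realizable_push_pop (i : 'I_k) (S : seq (letter k)) :
      realizable S ->
      realizable ([:: Alpha i; Edge Push] ++ S ++ [:: Edge Pop; Alpha i])
  | realizable_cat (i : 'I_k) (S1 S2 : seq (letter k)) :
      realizable ([:: Alpha i] ++ S1 ++ [:: Alpha i]) ->
      realizable ([:: Alpha i] ++ S2 ++ [:: Alpha i]) ->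
      realizable ([:: Alpha i] ++ S1 ++ [:: Alpha i] ++ S2 ++ [:: Alpha i]).

(* [elab G u v = None] means that (u, v) is not an edge; there is at most one
   edge, hence at most one label, for each ordered pair of vertices. *)
Record instance (V : finType) (k : nat) := Instance {
  vlab : V -> 'I_k;
  elab : V -> V -> option edge_label
}.

(* [dipath G a w b]: some directed path from a to b, possibly with repeated
   vertices, has label string w, which begins with the label of a and ends
   with the label of b. *)
Inductive dipath (V : finType) (k : nat) (G : instance V k) :
    V -> seq (letter k) -> V -> Prop :=
  | dipath_nil (a : V) : dipath G a [:: Alpha (vlab G a)] a
  | dipath_cons (a b c : V) (l : edge_label) (w : seq (letter k)) :
      elab G a b = Some l -> dipath G b w c ->
      dipath G a [:: Alpha (vlab G a), Edge l & w] c.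

Definition leads (V : finType) (k : nat) (G : instance V k) (a b : V) : Prop :=
  exists w : seq (letter k), dipath G a w b /\ realizable w.

(* [w1] ends with the label of c and [w2] begins with the label of d. As c and
   d are identified, this common label occurs once: hence the [behead]. *)
Definition leads_gap (V : finType) (k : nat) (G : instance V k)
    (a c d b : V) : Prop :=
  [/\ vlab G a = vlab G b, vlab G c = vlab G d &
      exists w1 w2 : seq (letter k),
        [/\ dipath G a w1 c, dipath G d w2 b & realizable (w1 ++ behead w2)]].

(* A pair (Upsilon, E) of Boolean arrays, indexed by (a, (c, d), b) and
   by (a, b). *)
Definition matrices (V : finType) : Type :=
  ({ffun V * (V * V) * V -> bool} * {ffun V * V -> bool})%type.

(* Only pairs of vertices with equal labels are recorded: an eps edge, or a
   trivial gap a ~> (a, b) ~> b, between vertices with different labels is on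
   no realizable path, but it would survive [square]. *)
Definition matrix_of (V : finType) (k : nat) (G : instance V k) : matrices V :=
  ([ffun t : V * (V * V) * V =>
      let: (a, (c, d), b) := t in
      [|| [&& elab G a c == Some Push, elab G d b == Some Pop,
              vlab G a == vlab G b & vlab G c == vlab G d],
          [&& a == b, b == c & c == d] |
          [&& c == a, d == b & vlab G a == vlab G b]]],
   [ffun t : V * V =>
      let: (u, v) := t in
      (u == v) || (elab G u v == Some Eps) && (vlab G u == vlab G v)]).

Definition square (V : finType) (M : matrices V) : matrices V :=
  let U := M.1 in
  let E := M.2 in
  let E' : {ffun V * V -> bool} := [ffun t : V * V =>
    let: (a, b) := t in
    [exists c : V, exists e : V, exists f : V, exists g : V, exists d : V,
      [&& U (a, (c, d), b), U (c, (e, f), g), E (e, f) & E (g, d)]]] in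
  let U' : {ffun V * (V * V) * V -> bool} := [ffun t : V * (V * V) * V =>
    let: (a, (c, d), b) := t in
    [exists c' : V, exists e' : V, exists f' : V, exists g' : V, exists d' : V,
      [&& U (a, (c', d'), b), U (c', (e', f'), g'),
          U (e', (c, d), f') & E' (g', d')]]
    || [exists c' : V, exists e' : V, exists f' : V, exists g' : V,
          exists d' : V,
      [&& U (a, (c', d'), b), U (c', (e', f'), g'),
          E' (e', f') & U (g', (c, d), d')]]] in
  (U', E').

(* The defining properties of the transitive closure; they determine [M]. *)
Definition is_transitive_closure (V : finType) (k : nat) (G : instance V k)
    (M : matrices V) : Prop :=
  (forall a b : V, M.2 (a, b) <-> leads G a b) /\
  (forall a b c d : V, M.1 (a, (c, d), b) <-> leads_gap G a c d b).

(* Every realizable pair has a realizable string of length at most n ^ p, where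
   n is the number of vertices. Without such a bound the shortest realizable
   string may have length exponential in n, while one [square] multiplies the
   lengths of the strings that are accounted for by at most a constant.
   The bound holds with p = 2 if every realizable pair is joined by a
   realizable path without repeated vertices: its string has length at most
   2 n - 1. Nothing is required of the paths with a gap. *)
Definition poly_witnessed (p : nat) (V : finType) (k : nat)
    (G : instance V k) : Prop :=
  forall a b : V, leads G a b ->
    exists w : seq (letter k),
      [/\ dipath G a w b, realizable w & size w <= #|V| ^ p].

(* Main.v *)
Require Import Defs.
From mathcomp Require Import all_boot.
From mathcomp Require Import zify.

(** A realizable path is built from a parse tree, and a gap is a walk from the
    root of a tree to a leaf. Size is the number of edges. In a tree of size
    [m] with [h < m <= 2h+1], the lowest node of size greater than [h] has
    only parts of size at most [h] above and below it (for a gap, below it and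
    towards the hole); this is exactly the decomposition that [square] sums
    over. So if [M] accounts for all trees and gaps of size at most [h], then
    [square M] accounts for those of size at most [2h+1]. A gap is moreover a
    walk on pairs of vertices, hence may be taken with fewer than [n^2] steps,
    each of which is cheap by [poly_witnessed]. *)

Set Implicit Arguments.
Unset Strict Implicit.
Unset Printing Implicit Defensive.

(** * Realizable strings as lists of edge and vertex labels *)

Section Strings.
Variable k : nat.
Implicit Types (i j : 'I_k) (s : seq (edge_label * 'I_k)).

Fixpoint letters s : seq (letter k) :=
  if s is (l, j) :: s' then [:: Edge l, Alpha j & letters s'] else [::].

(* [realizes i s] says that the letter [Alpha i] followed by [letters s] is
   realizable; dropping the first letter turns [realizable_cat] into plain
   concatenation. *)
Inductive realizes : 'I_k -> seq (edge_label * 'I_k) -> Prop :=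
  | realizes_nil i : realizes i [::]
  | realizes_eps i : realizes i [:: (Eps, i)]
  | realizes_push_pop i j s :
      realizes j s -> realizes i ((Push, j) :: s ++ [:: (Pop, i)])
  | realizes_cat i s1 s2 :
      realizes i s1 -> realizes i s2 -> realizes i (s1 ++ s2).

Lemma letters_cat s1 s2 : letters (s1 ++ s2) = letters s1 ++ letters s2.
Proof. by elim: s1 => //= -[l j] s1 ->. Qed.

Lemma letters_inj : injective letters.
Proof. by elim=> [|[l i] s IH] [|[l' i'] s'] //= [-> -> /IH ->]. Qed.

Lemma size_letters s : size (letters s) = (size s).*2.
Proof. by elim: s => //= -[l j] s /= ->. Qed.

Lemma realizes_last i s : realizes i s -> last i (map snd s) = i.
Proof.
elim=> // {s} [j j' s _ _|j s1 s2 _ IH1 _ IH2].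
  by rewrite map_cons map_cat /= last_cat.
by rewrite map_cat last_cat IH1.
Qed.

Lemma realizable_realizes (w : seq (letter k)) : realizable w ->
  exists i s, w = Alpha i :: letters s /\ realizes i s.
Proof.
elim=> {w} [i|i|i S _ [j [s [-> Hs]]]
  |i S1 S2 _ [i1 [s1 [e1 H1]]] _ [i2 [s2 [e2 H2]]]].
- by exists i, [::]; split=> //; constructor.
- by exists i, [:: (Eps, i)]; split=> //; constructor.
- exists i, ((Push, j) :: s ++ [:: (Pop, i)]).
  by split; [rewrite /= letters_cat|constructor].
- case: e1 H1 => <- e1 H1; case: e2 H2 => <- e2 H2.
  exists i, (s1 ++ s2); split; last by constructor.
  by rewrite letters_cat -e1 -e2 /= -!catA.
Qed.

(** [realizable_cat] wants each half closed by its own [Alpha i]. By [realizes_last] a nonempty half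
    ends with this letter, which [lastE] exposes; an empty half leaves nothing to concatenate. *)
Lemma realizes_realizable i s : realizes i s -> realizable (Alpha i :: letters s).
Proof.
have lastE j s' : realizes j s' -> s' = [::] \/
    exists S, letters s' = S ++ [:: Alpha j].
  case/lastP: s' => [|s' [l j']] Hs; [by left|right].
  move/realizes_last: Hs; rewrite map_rcons last_rcons /= => <-.
  by exists (letters s' ++ [:: Edge l]); rewrite -cats1 letters_cat -catA.
elim=> {i s} [i|i|i j s _ IH|i s1 s2 H1 IH1 H2 IH2].
- exact: realizable_one.
- exact: realizable_eps.
- by rewrite /= letters_cat; apply: (realizable_push_pop i IH).
- rewrite letters_cat.
  case: (lastE _ _ H1) => [->|[S1 e1]] //.
  case: (lastE _ _ H2) => [->|[S2 e2]]; first by rewrite cats0.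
  rewrite e1 e2 in IH1 IH2 *; rewrite -catA.
  exact: (@realizable_cat k i S1 S2).
Qed.

Lemma realizable_lettersP i s : realizable (Alpha i :: letters s) <-> realizes i s.
Proof.
split; last exact: realizes_realizable.
by case/realizable_realizes => j [s' [[<- /letters_inj ->]]].
Qed.

End Strings.

(** * Walks in the graph, with and without a gap *)

Section Graph.
Variables (V : finType) (k : nat) (G : instance V k).
Implicit Types (a b c d e f : V) (M : matrices V).

Fixpoint walk a (s : seq (edge_label * 'I_k)) b : Prop :=
  if s is (l, j) :: s' then
    exists c, [/\ elab G a c = Some l, vlab G c = j & walk c s' b]
  else a = b.

Lemma walk_cat a s1 s2 b :
  walk a (s1 ++ s2) b <-> exists c, walk a s1 c /\ walk c s2 b.
Proof.
elim: s1 a => [|[l j] s1 IH] a /=.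
  by split=> [?|[c [-> //]]]; exists a.
split=> [[c [H1 H2 /IH[d [H3 H4]]]]|[d [[c [H1 H2 H3]] H4]]].
  by exists d; split=> //; exists c.
by exists c; split=> //; apply/IH; exists d.
Qed.

Lemma walk_vlab a s b : walk a s b -> vlab G b = last (vlab G a) (map snd s).
Proof.
by elim: s a => [|[l j] s IH] a /= => [->|[c [_ <- /IH]]].
Qed.

Lemma dipathP a w b :
  dipath G a w b <-> exists s, w = Alpha (vlab G a) :: letters s /\ walk a s b.
Proof.
split=> [|[s [-> ]]].
  elim=> {a w b} [a|a b c l w H _ [s [-> Hs]]]; first by exists [::].
  by exists ((l, vlab G b) :: s); split=> //; exists b.
elim: s a => [|[l j] s IH] a /= => [->|[c [H <- /IH]]]; first by constructor.
exact: dipath_cons.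
Qed.

Lemma leadsP a b : leads G a b <-> exists s, walk a s b /\ realizes (vlab G a) s.
Proof.
split=> [[w [/dipathP[s [-> Hs]] /realizable_lettersP Hr]]|[s [Hs Hr]]].
  by exists s.
exists (Alpha (vlab G a) :: letters s).
by split; [apply/dipathP; exists s|apply/realizable_lettersP].
Qed.

(** Since [letters] leaves out the label of the starting vertex, identifying [c] with [d] amounts to
    concatenating [s1] and [s2]. *)
Lemma leads_gapP a b c d : leads_gap G a c d b <->
  [/\ vlab G a = vlab G b, vlab G c = vlab G d & exists s1 s2,
    [/\ walk a s1 c, walk d s2 b & realizes (vlab G a) (s1 ++ s2)]].
Proof.
split=> -[Hab Hcd].
  move=> [w1 [w2 [/dipathP[s1 [-> H1]] /dipathP[s2 [-> H2]]]]].
  rewrite /= -letters_cat => /realizable_lettersP Hr.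
  by split=> //; exists s1, s2.
move=> [s1 [s2 [H1 H2 Hr]]]; split=> //.
exists (Alpha (vlab G a) :: letters s1), (Alpha (vlab G d) :: letters s2).
split; [by apply/dipathP; exists s1|by apply/dipathP; exists s2|].
by rewrite /= -letters_cat; apply/realizable_lettersP.
Qed.

(** * Parse trees on vertices, measured by their number of edges *)

Definition push_pop a c d b : bool :=
  [&& elab G a c == Some Push, elab G d b == Some Pop,
      vlab G a == vlab G b & vlab G c == vlab G d].

Inductive derives : nat -> V -> V -> Prop :=
  | derives_refl a : derives 0 a a
  | derives_eps a b :
      elab G a b = Some Eps -> vlab G a = vlab G b -> derives 1 a b
  | derives_push_pop m a c d b :
      push_pop a c d b -> derives m c d -> derives m.+2 a b
  | derives_cat m1 m2 a c b :
      derives m1 a c -> derives m2 c b -> derives (m1 + m2) a b.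

(** A parse tree with a hole, read from the root: each step enters one push-pop pair or leaves one
    whole tree aside. This linear form lets the walk to the hole be cut anywhere, and later
    shortened. *)
Inductive derives_gap : nat -> V -> V -> V -> V -> Prop :=
  | derives_gap_refl a b : vlab G a = vlab G b -> derives_gap 0 a a b b
  | derives_gap_push_pop m a a' c d b' b : push_pop a a' b' b ->
      derives_gap m a' c d b' -> derives_gap m.+2 a c d b
  | derives_gap_catl m1 m2 a a' c d b : derives m1 a a' ->
      derives_gap m2 a' c d b -> derives_gap (m1 + m2) a c d b
  | derives_gap_catr m1 m2 a c d b' b : derives_gap m1 a c d b' ->
      derives m2 b' b -> derives_gap (m1 + m2) a c d b.

Lemma derives_vlab m a b : derives m a b -> vlab G a = vlab G b.
Proof.
by elim=> // {m a b} [m a c d b /and4P[_ _ /eqP]|m1 m2 a c b _ -> _ ->].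
Qed.

Lemma derives_gap_vlab m a c d b : derives_gap m a c d b ->
  vlab G a = vlab G b /\ vlab G c = vlab G d.
Proof.
elim=> {m a c d b} [a b|m a a' c d b' b /and4P[_ _ /eqP -> _] _ [_ ->]
  |m1 m2 a a' c d b /derives_vlab-> _ //|m1 m2 a c d b' b _ [-> ->]] //.
by move/derives_vlab->.
Qed.

Lemma derives_gap_trans m1 m2 a c e f d b : derives_gap m1 a c d b ->
  derives_gap m2 c e f d -> derives_gap (m1 + m2) a e f b.
Proof.
move=> H; elim: H e f => {m1 a c d b} [a b _ //|m a a' c d b' b Hpp _ IH
  |m1 m1' a a' c d b H1 _ IH|m1 m1' a c d b' b _ IH H1] e f H2.
- by rewrite !addSn; apply: derives_gap_push_pop Hpp (IH _ _ H2).
- by rewrite -addnA; apply: derives_gap_catl H1 (IH _ _ H2).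
- by rewrite addnAC; apply: derives_gap_catr (IH _ _ H2) H1.
Qed.

Lemma derives_gap_fill m1 m2 a c d b : derives_gap m1 a c d b ->
  derives m2 c d -> derives (m1 + m2) a b.
Proof.
move=> H; elim: H => {m1 a c d b} [a b _ //|m a a' c d b' b Hpp _ IH
  |m1 m1' a a' c d b H1 _ IH|m1 m1' a c d b' b _ IH H1] H2.
- by rewrite !addSn; apply: derives_push_pop Hpp (IH H2).
- by rewrite -addnA; apply: derives_cat H1 (IH H2).
- by rewrite addnAC; apply: derives_cat (IH H2) H1.
Qed.

Lemma realizes_derives a s b :
  walk a s b -> realizes (vlab G a) s -> derives (size s) a b.
Proof.
move=> + H; move E: (vlab G a) H => i H.
elim: H a b E => {i s} [i|i|i j s Hj IH|i s1 s2 H1 IH1 _ IH2] a b ai.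
- by move=> /= ->; apply: derives_refl.
- by move=> /= [c [H ci <-]]; apply: derives_eps => //; rewrite ai ci.
- move=> /= [c [H cj /walk_cat[d [Hs /= [b' [H' bi <-]]]]]].
  rewrite size_cat addn1; apply: derives_push_pop (IH _ _ cj Hs).
  rewrite /push_pop H H' ai bi !eqxx /=.
  by rewrite (walk_vlab Hs) cj realizes_last.
- rewrite size_cat => /walk_cat[c [Hac Hcb]].
  apply: derives_cat (IH1 _ _ ai Hac) (IH2 _ _ _ Hcb).
  by rewrite (walk_vlab Hac) ai; apply: realizes_last.
Qed.

(** Induction on the string, following where the cut between [s1] and [s2] falls. At an end of an
    eps or push-pop string, one side is a whole tree next to a trivial gap; inside a push-pop pair
    the induction hypothesis applies; in a concatenation the half without the cut is left aside. The
    size is not tracked, because [short_derives_gap] bounds it anew. *)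
Lemma realizes_derives_gap a s1 c d s2 b : walk a s1 c -> walk d s2 b ->
  vlab G c = vlab G d -> realizes (vlab G a) (s1 ++ s2) ->
  exists m, derives_gap m a c d b.
Proof.
move=> + + + H; move Ei: (vlab G a) H => i H; move Es: (s1 ++ s2) H => s H.
elim: H a c d b s1 s2 Ei Es => {i s} [i|i|i j s Hj IH|i t1 t2 Ht1 IH1 Ht2 IH2]
    a c d b s1 s2 ai Es H1 H2 cd.
- case: s1 s2 Es H1 H2 => [|//] [|//] _ /= ac db; exists 0.
  by rewrite -ac -db; constructor; rewrite ac.
- case: s1 Es H1 => [|x s1] /= Es H1.
    have db : derives (size s2) d b.
      by apply: realizes_derives H2 _; rewrite Es -cd -H1 ai; constructor.
    subst c; exists (0 + size s2).
    exact: derives_gap_catr (derives_gap_refl cd) db.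
  case: x s1 s2 Es H1 H2 => l j [|//] [|//] [-> ->] /= [e [He ei ec]] db.
  subst e b; exists (1 + 0); apply: derives_gap_catl (derives_gap_refl cd).
  by apply: derives_eps => //; rewrite ai ei.
- case: s1 Es H1 => [|x s1] /= Es H1.
    have db : derives (size s2) d b.
      apply: realizes_derives H2 _; rewrite Es -cd -H1 ai.
      exact: realizes_push_pop.
    subst c; exists (0 + size s2).
    exact: derives_gap_catr (derives_gap_refl cd) db.
  case: x Es H1 => l j' [-> -> Es] [a' [Ha a'j H1]].
  case/lastP: s2 Es H2 => [|s2 [l' i']].
    rewrite cats0 => /= Es db; subst b.
    have ac : derives (size ((Push, j) :: s1)) a c.
      apply: (@realizes_derives a ((Push, j) :: s1)); first by exists a'.
      by rewrite Es ai; apply: realizes_push_pop.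
    exists (size ((Push, j) :: s1) + 0).
    exact: derives_gap_catl ac (derives_gap_refl cd).
  rewrite -rcons_cat cats1 => /rcons_inj[Es -> ->].
  rewrite -cats1 => /walk_cat[b' [H2 /= [x [Hb xi xb]]]]; subst x.
  have [m Hm] := IH _ _ _ _ _ _ a'j Es H1 H2 cd.
  exists m.+2; apply: derives_gap_push_pop Hm.
  rewrite /push_pop Ha Hb ai xi !eqxx /=; apply/eqP.
  (* The inner string returns to the label [j], and the jump from [c] to [d] keeps the label, so
     [a'] and [b'] have equal labels. *)
  move: (realizes_last Hj); rewrite -Es map_cat last_cat.
  by rewrite -a'j -(walk_vlab H1) cd -(walk_vlab H2).
(* [r] is the stretch between the cut of [s1 ++ s2] and that of [t1 ++ t2]; the two cases put the
   gap in [t2] and in [t1]. *)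
- have [r [[Es1 Et2]|[Et1 Es2]]] : exists r,
      (s1 = t1 ++ r /\ t2 = r ++ s2) \/ (t1 = s1 ++ r /\ s2 = r ++ t2).
    elim: s1 t1 Es {H1 Ht1 IH1} => [|x s1 IHs] [|y t1] /=.
    + by move=> ->; exists [::]; right.
    + by move=> ->; exists (y :: t1); right.
    + by move=> <-; exists (x :: s1); left.
    + by case=> -> /IHs[r [[-> ->]|[-> ->]]]; exists r; [left|right].
  + move: H1; rewrite Es1 => /walk_cat[e [He Hr]].
    have ei : vlab G e = i by rewrite (walk_vlab He) ai realizes_last.
    have [m Hm] := IH2 _ _ _ _ _ _ ei (esym Et2) Hr H2 cd.
    exists (size t1 + m); apply: derives_gap_catl Hm.
    by apply: realizes_derives He _; rewrite ai.
  + move: H2; rewrite Es2 => /walk_cat[e [Hr He]].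
    have [m Hm] := IH1 _ _ _ _ _ _ ai (esym Et1) H1 Hr cd.
    have ei : vlab G e = i.
      rewrite (walk_vlab Hr) -cd (walk_vlab H1) ai -last_cat -map_cat -Et1.
      exact: realizes_last.
    exists (m + size t2); apply: derives_gap_catr Hm _.
    by apply: realizes_derives He _; rewrite ei.
Qed.

Lemma derives_leads m a b : derives m a b -> leads G a b.
Proof.
move=> H; apply/leadsP; elim: H => {m a b}
    [a|a b H ab|m a c d b /and4P[/eqP Hac /eqP Hdb /eqP ab _] _ [s [Hs Hr]]
    |m1 m2 a c b /derives_vlab ac [s1 [Hs1 Hr1]] _ [s2 [Hs2 Hr2]]].
- by exists [::]; split=> //; constructor.
- exists [:: (Eps, vlab G b)]; split; first by exists b.
  by rewrite ab; constructor.
- exists ((Push, vlab G c) :: s ++ [:: (Pop, vlab G b)]); split.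
    by exists c; split=> //; apply/walk_cat; exists d; split=> //; exists b.
  by rewrite ab; constructor.
- exists (s1 ++ s2); split; first by apply/walk_cat; exists c.
  by apply: realizes_cat => //; rewrite ac.
Qed.

Lemma derives_gap_leads_gap m a c d b :
  derives_gap m a c d b -> leads_gap G a c d b.
Proof.
move=> H; have [ab cd] := derives_gap_vlab H.
apply/leads_gapP; split=> //; elim: H {ab cd} => {m a c d b}
    [a b ab|m a a' c d b' b /and4P[/eqP Ha /eqP Hb /eqP ab _] _
       [s1 [s2 [H1 H2 Hr]]]
    |m1 m2 a a' c d b H _ [s1 [s2 [H1 H2 Hr]]]
    |m1 m2 a c d b' b H' [s1 [s2 [H1 H2 Hr]]] H].
- by exists [::], [::]; split=> //; constructor.
- exists ((Push, vlab G a') :: s1), (s2 ++ [:: (Pop, vlab G b)]); split.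
  + by exists a'.
  + by apply/walk_cat; exists b'; split=> //; exists b.
  + by rewrite cat_cons catA ab; constructor.
- have /leadsP[s [Hs Hrs]] := derives_leads H.
  exists (s ++ s1), s2; split=> //; first by apply/walk_cat; exists a'.
  by rewrite -catA; apply: realizes_cat => //; rewrite (derives_vlab H).
- have /leadsP[s [Hs Hrs]] := derives_leads H.
  exists s1, (s2 ++ s); split=> //; first by apply/walk_cat; exists b'.
  by rewrite catA; apply: realizes_cat => //; rewrite (derives_gap_vlab H').1.
Qed.

Lemma dipath_derives a w b : dipath G a w b -> realizable w ->
  exists2 m, m < size w & derives m a b.
Proof.
move=> /dipathP[s [-> Hs]] /realizable_lettersP /(realizes_derives Hs) H.
(* A string with [m] edges has [2 * m + 1] letters. *)
by exists (size s) => //=; rewrite size_letters -addnn ltnS leq_addr.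
Qed.

Lemma leads_derivesP a b : leads G a b <-> exists m, derives m a b.
Proof.
split=> [[w [Hw /(dipath_derives Hw)[m _ H]]]|[m /derives_leads //]].
by exists m.
Qed.

Lemma leads_gap_derivesP a c d b :
  leads_gap G a c d b <-> exists m, derives_gap m a c d b.
Proof.
split=> [/leads_gapP[_ cd [s1 [s2 [H1 H2 Hr]]]]|[m /derives_gap_leads_gap //]].
exact: realizes_derives_gap H1 H2 cd Hr.
Qed.

(** * Initial gaps, and cutting a tree at its lowest large node *)

Definition base_gap a c d b : bool :=
  push_pop a c d b || [&& c == a, d == b & vlab G a == vlab G b].

Lemma base_gap_refl a b : vlab G a = vlab G b -> base_gap a a b b.
Proof. by move=> ab; rewrite /base_gap ab !eqxx orbT. Qed.

Lemma matrix_of_gap a c d b : (matrix_of G).1 (a, (c, d), b) = base_gap a c d b.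
Proof.
rewrite ffunE /base_gap /push_pop.
case: [&& _, _, _ & _] => //=; case: and3P => [[/eqP -> /eqP -> /eqP ->]|//].
by rewrite !eqxx.
Qed.

Lemma base_gap_derives a c d b :
  base_gap a c d b -> exists m, derives_gap m a c d b.
Proof.
case/orP=> [H|/and3P[/eqP -> /eqP -> /eqP ab]]; last by exists 0; constructor.
exists 2; apply: derives_gap_push_pop (H) (derives_gap_refl _).
by case/and4P: H => _ _ _ /eqP.
Qed.

(** Descend as long as some part is larger than [h]. The node reached keeps more than [h] edges,
    whence [m1 + h < m]. If it is a push-pop node, [base_gap] is its pair of edges and [g = d]; if
    it is a concatenation, [base_gap] is trivial and the factors are [(e, f)] and [(g, d)]. An eps
    edge is reached only for [h = 0], hence [maxn h 1]. *)
Lemma derives_split h m a b : derives m a b -> h < m ->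
  exists c e f g d m1 m2 m3,
    [/\ derives_gap m1 a c d b /\ m1 + h < m, base_gap c e f g,
        derives m2 e f /\ m2 <= maxn h 1 & derives m3 g d /\ m3 <= h].
Proof.
elim=> {m a b} [//|a b Hab ab hm|m a c d b Hpp Hcd IH hm
  |m1 m2 a c b H1 IH1 H2 IH2 hm].
- exists a, a, b, b, b, 0, 1, 0.
  split; try (split; [by constructor|by rewrite ?leq_maxr]).
  exact: base_gap_refl.
- case: (ltnP h m) => [hm'|hm']; last first.
    exists a, c, d, b, b, 0, m, 0; split.
    + by split=> //; constructor; case/and4P: Hpp => _ _ /eqP.
    + by rewrite /base_gap Hpp.
    + by rewrite leq_max hm'.
    + by split=> //; constructor.
  have [c' [e [f [g [d' [n1 [n2 [n3 [[Hg hn] Hb He Hgd]]]]]]]]] := IH hm'.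
  exists c', e, f, g, d', n1.+2, n2, n3; split=> //; split; last by lia.
  exact: derives_gap_push_pop Hpp Hg.
- case: (ltnP h m1) => [hm'|hm1].
    have [c' [e [f [g [d' [n1 [n2 [n3 [[Hg hn] Hb He Hgd]]]]]]]]] := IH1 hm'.
    exists c', e, f, g, d', (n1 + m2), n2, n3; split=> //; split; last by lia.
    exact: derives_gap_catr Hg H2.
  case: (ltnP h m2) => [hm'|hm2].
    have [c' [e [f [g [d' [n1 [n2 [n3 [[Hg hn] Hb He Hgd]]]]]]]]] := IH2 hm'.
    exists c', e, f, g, d', (m1 + n1), n2, n3; split=> //; split; last by lia.
    exact: derives_gap_catl H1 Hg.
  have ac := derives_vlab H1; have cb := derives_vlab H2.
  exists a, a, c, c, b, 0, m1, m2; split; rewrite ?leq_max ?hm1 //.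
  + by split=> //; constructor; rewrite ac.
  + exact: base_gap_refl.
Qed.

(** The descent only goes towards the hole, so the whole tree left aside at the last node may have
    any size up to [m]. This is harmless: [square] updates the second matrix first, and the updated
    one covers such trees. The two alternatives, hole in [(e, f)] or in [(g, d')], are the two sums
    of [square]. *)
Lemma derives_gap_split h m a c d b : derives_gap m a c d b -> h < m ->
  exists c' e f g d' m1 m2 m3,
    [/\ derives_gap m1 a c' d' b /\ m1 + h < m, base_gap c' e f g &
        ([/\ derives_gap m2 e c d f, m2 <= h, derives m3 g d' & m3 <= m] \/
         [/\ derives m3 e f, m3 <= m, derives_gap m2 g c d d' & m2 <= h])].
Proof.
elim=> {m a c d b} [//|m a a' c d b' b Hpp H IH hm
  |m1 m2 a a' c d b H1 H IH hm|m1 m2 a c d b' b H IH H2 hm].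
- case: (ltnP h m) => [hm'|hm'].
    have [x [e [f [g [y [n1 [n2 [n3 [[Hg hn] Hb Hr]]]]]]]]] := IH hm'.
    exists x, e, f, g, y, n1.+2, n2, n3; split=> //.
      by split; [apply: derives_gap_push_pop Hpp Hg|lia].
    by case: Hr => -[? ? ? ?]; [left|right]; split=> //; lia.
  exists a, a', b', b, b, 0, m, 0; split.
  + by split=> //; constructor; case/and4P: Hpp => _ _ /eqP.
  + by rewrite /base_gap Hpp.
  + by left; split=> //; constructor.
- case: (ltnP h m2) => [hm'|hm'].
    have [x [e [f [g [y [n1 [n2 [n3 [[Hg hn] Hb Hr]]]]]]]]] := IH hm'.
    exists x, e, f, g, y, (m1 + n1), n2, n3; split=> //.
      by split; [apply: derives_gap_catl H1 Hg|lia].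
    by case: Hr => -[? ? ? ?]; [left|right]; split=> //; lia.
  have ab : vlab G a = vlab G b.
    by rewrite (derives_vlab H1) (derives_gap_vlab H).1.
  exists a, a, a', a', b, 0, m2, m1; split.
  + by split=> //; constructor.
  + exact: base_gap_refl (derives_vlab H1).
  + by right; split=> //; lia.
- case: (ltnP h m1) => [hm'|hm'].
    have [x [e [f [g [y [n1 [n2 [n3 [[Hg hn] Hb Hr]]]]]]]]] := IH hm'.
    exists x, e, f, g, y, (n1 + m2), n2, n3; split=> //.
      by split; [apply: derives_gap_catr Hg H2|lia].
    by case: Hr => -[? ? ? ?]; [left|right]; split=> //; lia.
  have ab' := (derives_gap_vlab H).1.
  exists a, a, b', b', b, 0, m1, m2; split.
  + by split=> //; constructor; rewrite ab' (derives_vlab H2).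
  + exact: base_gap_refl.
  + by left; split=> //; lia.
Qed.

(** * Soundness and coverage of iterated squaring *)

Lemma squareE M a b : (square M).2 (a, b) <-> exists c e f g d,
  [/\ M.1 (a, (c, d), b), M.1 (c, (e, f), g), M.2 (e, f) & M.2 (g, d)].
Proof.
rewrite ffunE; split.
  case/existsP=> c /existsP[e /existsP[f /existsP[g /existsP[d /and4P[]]]]].
  by exists c, e, f, g, d.
case=> c [e [f [g [d [H1 H2 H3 H4]]]]].
apply/existsP; exists c; apply/existsP; exists e; apply/existsP; exists f.
by apply/existsP; exists g; apply/existsP; exists d; rewrite H1 H2 H3 H4.
Qed.

Lemma square_gapE M a c d b : (square M).1 (a, (c, d), b) <->
  exists c' e f g d', [/\ M.1 (a, (c', d'), b), M.1 (c', (e, f), g) &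
    (M.1 (e, (c, d), f) /\ (square M).2 (g, d')) \/
    ((square M).2 (e, f) /\ M.1 (g, (c, d), d'))].
Proof.
rewrite [(square M).1 _]ffunE; split.
  case/orP=> /existsP[c' /existsP[e /existsP[f /existsP[g /existsP[d' /and4P[]]]]]]
    H1 H2 H3 H4; exists c', e, f, g, d'; split=> //; [left|right]; by [].
case=> c' [e [f [g [d' [H1 H2 H3]]]]].
apply/orP; case: H3 => -[H3 H4]; [left|right];
  apply/existsP; exists c'; apply/existsP; exists e; apply/existsP; exists f;
  apply/existsP; exists g; apply/existsP; exists d';
  by apply/and4P; split.
Qed.

Definition sound M : Prop :=
  (forall a b, M.2 (a, b) -> exists m, derives m a b) /\
  (forall a c d b, M.1 (a, (c, d), b) -> exists m, derives_gap m a c d b).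

(* [maxn h 1]: at the start an eps edge, of size 1, is in the second matrix,
   while the first one has no gap of size 1. *)
Definition covers h M : Prop :=
  [/\ forall a c d b, base_gap a c d b -> M.1 (a, (c, d), b),
      forall m a b, derives m a b -> m <= maxn h 1 -> M.2 (a, b) &
      forall m a c d b, derives_gap m a c d b -> m <= h -> M.1 (a, (c, d), b)].

Lemma matrix_of_sound : sound (matrix_of G).
Proof.
split=> [a b|a c d b]; last by rewrite matrix_of_gap; apply: base_gap_derives.
rewrite ffunE => /orP[/eqP ->|/andP[/eqP H /eqP ab]].
  by exists 0; constructor.
by exists 1; constructor.
Qed.

Lemma square_sound M : sound M -> sound (square M).
Proof.
case=> sE sU; have sE' a b : (square M).2 (a, b) -> exists m, derives m a b.
  case/squareE=> c [e [f [g [d []]]]].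
  move=> /sU[m1 H1] /sU[m2 H2] /sE[m3 H3] /sE[m4 H4].
  exists (m1 + (m2 + m3 + m4)); apply: derives_gap_fill H1 _.
  exact: derives_cat (derives_gap_fill H2 H3) H4.
split=> // a c d b /square_gapE[c' [e [f [g [d' [/sU[m1 H1] /sU[m2 H2]]]]]]].
case=> -[]; last first.
  move=> /sE'[m3 H3] /sU[m4 H4]; exists (m1 + (m2 + m3 + m4)).
  apply: derives_gap_trans H1 _.
  exact: derives_gap_catl (derives_gap_fill H2 H3) H4.
move=> /sU[m3 H3] /sE'[m4 H4]; exists (m1 + (m2 + m3 + m4)).
apply: derives_gap_trans H1 _.
exact: derives_gap_catr (derives_gap_trans H2 H3) H4.
Qed.

Lemma derives0_eq a b : derives 0 a b -> a = b.
Proof.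
move E: 0 => m H; elim: H E => // m1 m2 x z y _ IH1 _ IH2 /esym/eqP.
by rewrite addn_eq0 => /andP[/eqP/esym/IH1 -> /eqP/esym/IH2].
Qed.

Lemma derives_le1 m a b : derives m a b -> m <= 1 -> (matrix_of G).2 (a, b).
Proof.
elim=> {m a b} [a _|a b H ab _|//|m1 m2 a c b H1 IH1 H2 IH2 m12].
- by rewrite ffunE eqxx.
- by rewrite ffunE H ab !eqxx orbT.
- case: (posnP m1) => [m10|m1_gt0].
    by move: H1; rewrite m10 => /derives0_eq->; apply: IH2; lia.
  have m20 : m2 = 0 by lia.
  by move: H2; rewrite m20 => /derives0_eq<-; apply: IH1; lia.
Qed.

Lemma matrix_of_covers : covers 0 (matrix_of G).
Proof.
split=> [a c d b|m a b|m a c d b H m0]; first by rewrite matrix_of_gap.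
  exact: derives_le1.
rewrite matrix_of_gap; move: H m0.
elim=> {m a c d b} [a b ab _|//|m1 m2 a a' c d b H1 _ IH|m1 m2 a c d b' b _ IH H2].
- exact: base_gap_refl.
- rewrite leqn0 addn_eq0 => /andP[/eqP m10 /eqP m20].
  by move: H1; rewrite m10 => /derives0_eq->; apply: IH; rewrite m20.
- rewrite leqn0 addn_eq0 => /andP[/eqP m10 /eqP m20].
  by move: H2; rewrite m20 => /derives0_eq<-; apply: IH; rewrite m10.
Qed.

Lemma square_covers h M : covers h M -> covers h.*2.+1 (square M).
Proof.
case=> cB cE cU.
have cE' m a b : derives m a b -> m <= h.*2.+1 -> (square M).2 (a, b).
  move=> H mh; apply/squareE; case: (ltnP h m) => [hm|hm].
    have [c [e [f [g [d [m1 [m2 [m3 [[H1 h1] Hb [H2 h2] [H3 h3]]]]]]]]]] :=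
      derives_split H hm.
    (* [m1 + h < m] and [m <= 2h+1] give [m1 <= h]. *)
    exists c, e, f, g, d; split; first by apply: cU H1 _; lia.
    + exact: cB.
    + exact: cE H2 h2.
    + by apply: cE H3 _; rewrite leq_max h3.
  (* A tree that is already covered persists: it takes the place of [(e, f)], and the other factors
     are trivial. *)
  have ab := derives_vlab H.
  exists a, a, b, b, b; split; try exact/cB/base_gap_refl.
    by apply: cE H _; rewrite leq_max hm.
  exact: cE (derives_refl b) _.
have cU' m a c d b : derives_gap m a c d b -> m <= h.*2.+1 ->
    (square M).1 (a, (c, d), b).
  move=> H mh; apply/square_gapE; case: (ltnP h m) => [hm|hm].
    have [c' [e [f [g [d' [m1 [m2 [m3 [[H1 h1] Hb Hr]]]]]]]]] :=
      derives_gap_split H hm.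
    exists c', e, f, g, d'; split; [by apply: cU H1 _; lia|exact: cB|].
    case: Hr => -[H2 h2 H3 h3]; [left|right]; split.
    + exact: cU H2 h2.
    + by apply: cE' H3 _; lia.
    + by apply: cE' H2 _; lia.
    + exact: cU H3 h3.
  have [ab cd] := derives_gap_vlab H.
  exists a, a, b, b, b; split; try exact/cB/base_gap_refl.
  by left; split; [apply: cU H hm|apply: cE' (derives_refl b) _].
split=> // a c d b Hb.
case/orP: (Hb) => [Hpp|/and3P[/eqP ? /eqP ? /eqP ab]]; last first.
  by subst c d; apply: cU' (derives_gap_refl ab) _.
(* A push-pop pair is a gap of size 2, out of reach of [cU'] when [h = 0]; it persists through a
   product whose other factors are trivial. *)
have /and4P[_ _ _ /eqP cd] := Hpp.
apply/square_gapE; exists c, c, d, d, d; split;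
  [exact: cB|exact/cB/base_gap_refl|].
left; split; first exact/cB/base_gap_refl.
exact: cE' (derives_refl d) _.
Qed.

Lemma iter_square t : sound (iter t (@square V) (matrix_of G)) /\
  covers (2 ^ t).-1 (iter t (@square V) (matrix_of G)).
Proof.
elim: t => [|t [IHs IHc]]; first exact: (conj matrix_of_sound matrix_of_covers).
split; first exact: square_sound.
(* Iterating [h] to [2h+1] from 0 gives [2 ^ t - 1]. *)
have -> : (2 ^ t.+1).-1 = (2 ^ t).-1.*2.+1.
  by have := expn_gt0 2 t; rewrite expnS; lia.
exact: square_covers.
Qed.

(** * Short gaps, through paths on pairs of vertices *)

Definition gap_step (E : rel V) (x y : V * V) : bool :=
  (vlab G x.1 == vlab G x.2) &&
  [|| push_pop x.1 y.1 y.2 x.2, E x.1 y.1 && (x.2 == y.2) |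
      (x.1 == y.1) && E y.2 x.2].

(** [E] stands for derivability as a boolean relation, so that gaps become paths in a finite graph
    and can be shortened. It is later instantiated with the second matrix. *)
Lemma derives_gap_connect (E : rel V) m a c d b :
  (forall m' u v, derives m' u v -> E u v) ->
  derives_gap m a c d b -> connect (gap_step E) (a, b) (c, d).
Proof.
move=> HE; elim=> {m a c d b} [a b ab|m a a' c d b' b Hpp _|m1 m2 a a' c d b H1 H2
  |m1 m2 a c d b' b H1 + H2].
- exact: connect0.
- apply/connect_trans/connect1.
  by rewrite /gap_step /= Hpp andbT; case/and4P: Hpp.
- apply: connect_trans; apply: connect1.
  rewrite /gap_step /= (HE _ _ _ H1) (derives_vlab H1).
  by rewrite (derives_gap_vlab H2).1 !eqxx orbT.
- apply: connect_trans; apply: connect1.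
  rewrite /gap_step /= (HE _ _ _ H2) -(derives_vlab H2).
  by rewrite (derives_gap_vlab H1).1 !eqxx !orbT.
Qed.

Lemma path_derives_gap (E : rel V) q a b p c d : 0 < q ->
  (forall u v, E u v -> exists2 m, m < q & derives m u v) ->
  vlab G a = vlab G b ->
  path (gap_step E) (a, b) p -> last (a, b) p = (c, d) ->
  exists2 m, m <= size p * q.+1 & derives_gap m a c d b.
Proof.
move=> q0 HE; elim: p a b => [|[a' b'] p IH] a b ab /=.
  by move=> _ [<- <-]; exists 0; last exact: derives_gap_refl.
case/andP=> /andP[_ /=] Hst Hp Hl.
(* A push-pop pair costs 2, which is at most [q.+1] since [q] is positive; a whole tree costs less
   than [q]. *)
have [m1 m1q H1] : exists2 m, m <= q.+1 & derives_gap m a a' b' b.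
  case/or3P: Hst => [Hpp|/andP[/HE[m mq H] /eqP <-]|/andP[/eqP <- /HE[m mq H]]].
  - exists 2; first by [].
    apply: derives_gap_push_pop (Hpp) (derives_gap_refl _).
    by case/and4P: Hpp => _ _ _ /eqP.
  - exists (m + 0); first by lia.
    apply: derives_gap_catl (H) (derives_gap_refl _).
    by rewrite -(derives_vlab H).
  - exists (0 + m); first by lia.
    apply: derives_gap_catr (derives_gap_refl _) (H).
    by rewrite (derives_vlab H).
have [m mp H] := IH _ _ (derives_gap_vlab H1).2 Hp Hl.
by exists (m1 + m); [rewrite mulSn leq_add|apply: derives_gap_trans H1 H].
Qed.

(** A path on pairs of vertices without repetition has fewer than [#|V| ^ 2] steps, and each step
    can be realized at cost at most [q.+1], whatever the size [m] of the given gap. *)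
Lemma short_derives_gap (E : rel V) q m a c d b : 0 < q ->
  (forall u v, E u v <-> exists m', derives m' u v) ->
  (forall m' u v, derives m' u v -> exists2 m'', m'' < q & derives m'' u v) ->
  derives_gap m a c d b ->
  exists2 m', m' < #|V| ^ 4 * q & derives_gap m' a c d b.
Proof.
move=> q0 HE Hq H.
have /connectP[p0 Hp0 Hl0] : connect (gap_step E) (a, b) (c, d).
  by apply: derives_gap_connect H => m' u v Huv; apply/HE; exists m'.
case: (shortenP Hp0) Hl0 => p Hp Up _ Hl.
have [|m' Hm' H'] := path_derives_gap q0 _ (derives_gap_vlab H).1 Hp (esym Hl).
  by move=> u v /HE[n Hn]; apply: Hq Hn.
exists m' => //; apply: leq_ltn_trans Hm' _.
have : size ((a, b) :: p) <= #|V| ^ 2.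
  by rewrite -(card_uniqP Up) expnS expn1 -card_prod max_card.
(* With [#|V| ^ 2 = r.+1], the cost is at most [r * q.+1 <= r * r.+2 * q], and [r * r.+2] is one
   less than the square of [r.+1]. *)
rewrite -[4]/(2 + 2) expnD /=; case: (_ ^ 2) => // r /ltnSE pr.
apply: (@leq_ltn_trans (r * (r.+2 * q))).
  by apply: leq_mul => //; rewrite !mulSn; lia.
rewrite mulnA ltn_mul2r q0 /=; lia.
Qed.

(** * Number of squarings that reach the closure *)

Lemma iter_square_closure p t : poly_witnessed p G -> #|V| ^ (p + 4) <= 2 ^ t ->
  is_transitive_closure G (iter t (@square V) (matrix_of G)).
Proof.
move=> Gp Vt; set M := iter _ _ _; have [[sE sU] [_ cE cU]] := iter_square t.
case: (posnP #|V|) => [V0|V0].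
  by split=> a; move: (max_card (pred1 a)); rewrite card1 V0.
(* Pairs need sizes below [#|V| ^ p], gaps need sizes below [#|V| ^ 4 * #|V| ^ p]; sizes below
   [2 ^ t] are covered. *)
have qt : #|V| ^ p <= 2 ^ t.
  by apply: leq_trans Vt; rewrite leq_pexp2l // leq_addr.
have Hq m a b : derives m a b -> exists2 m', m' < #|V| ^ p & derives m' a b.
  move=> /derives_leads /Gp[w [Hw Hr sw]].
  have [m' m'w H] := dipath_derives Hw Hr.
  by exists m' => //; apply: leq_trans sw.
have HE a b : M.2 (a, b) <-> exists m, derives m a b.
  split=> [/sE //|[m /Hq[m' m'q H]]].
  by apply: cE H _; rewrite leq_max; apply/orP; left; lia.
split=> [a b|a b c d]; first by rewrite HE leads_derivesP.
rewrite leads_gap_derivesP; split=> [/sU //|[m Hm]].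
have q0 : 0 < #|V| ^ p by rewrite expn_gt0 V0.
have [m' m'q H] :=
  @short_derives_gap (fun u v => M.2 (u, v)) _ _ _ _ _ _ q0 HE Hq Hm.
apply: cU H _; rewrite -ltnS prednK ?expn_gt0 //; apply: leq_trans m'q _.
by rewrite mulnC -expnD.
Qed.

End Graph.

(* [trunc_log 2 n] is the integer part of the base-2 logarithm of n. The number
   [T n] of applications depends only on the number n of vertices and on the
   exponent p. *)
Theorem theorem8 (p : nat) :
  exists T : nat -> nat,
    (exists C : nat, forall n : nat, T n <= C * trunc_log 2 n) /\
    (forall (V : finType) (k : nat) (G : instance V k),
       poly_witnessed p G ->
       is_transitive_closure G (iter (T #|V|) (@square V) (matrix_of G))).
Proof.
(* For [n >= 2] and [L = trunc_log 2 n], [L >= 1] gives [n < 2 ^ (L + 1) <= 2 ^ (2 * L)]; hence the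
   doubling. Raising to the power [p + 4] gives the bound required by [iter_square_closure]. *)
exists (fun n => (p + 4).*2 * trunc_log 2 n); split.
  by exists (p + 4).*2.
move=> V k G Gp; apply: (iter_square_closure Gp).
rewrite -mul2n -mulnA mulnCA mulnC expnM leq_exp2r ?addn_gt0 ?orbT //.
have [V1|V1] := leqP #|V| 1; first by apply: leq_trans V1 _; rewrite expn_gt0.
apply: leq_trans (ltnW (trunc_log_ltn _ (ltnSn 1))) _.
by rewrite leq_exp2l // mul2n -addnn -addn1 leq_add2l trunc_log_gt0.
Qed.
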